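(* Consider, for $n\to\infty$, uniformly random directed hypergraphs with $n$ vertices and degree sequences $((d_v^{\mathrm{out}},d_v^{\mathrm{in}})_{v\in V},(\delta_e^{\mathrm{tail}},\delta_e^{\mathrm{head}})_{e\in E})$ (depending on $n$), and let $M_n$ be the number of multi-hyperedge pairs. Suppose $\delta_e^{\mathrm{tail}}=\delta^{\mathrm{tail}}$ and $\delta_e^{\mathrm{head}}=\delta^{\mathrm{head}}$ for all $e\in E$, with $\delta^{\mathrm{tail}},\delta^{\mathrm{head}}\in O(1)$, and 1. $\mathbb{E}[(d_U^{\mathrm{out}})^{2\delta^{\mathrm{tail}}}],\ \mathbb{E}[(d_U^{\mathrm{in}})^{2\delta^{\mathrm{head}}}] \in o(n)$; 2. there exists $c>0$ such that $\mathbb{P}(d_U^{\mathrm{out}} \geq 2\delta^{\mathrm{tail}})\ge c$ and $\mathbb{P}(d_U^{\mathrm{in}} \geq 2\delta^{\mathrm{head}}) \geq c$. Then $$\mathbb{E}[M_n] = \frac{(\delta^{\mathrm{tail}}-1)!\,(\delta^{\mathrm{head}}-1)!}{2}\, n^2\, \mathbb{E}[d_U^{\mathrm{out}}]\, \mathbb{E}[d_U^{\mathrm{in}}] \left( \frac{\mathbb{E}[(d_U^{\mathrm{out}})^2] - \mathbb{E}[d_U^{\mathrm{out}}]}{n\, \mathbb{E}[d_U^{\mathrm{out}}]^2} \right)^{\delta^{\mathrm{tail}}} \left( \frac{\mathbb{E}[(d_U^{\mathrm{in}})^2] - \mathbb{E}[d_U^{\mathrm{in}}]}{n\, \mathbb{E}[d_U^{\mathrm{in}}]^2}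 \right)^{\delta^{\mathrm{head}}} (1+o(1)).$$
   Context: All asymptotics are as $n=|V|\to\infty$, along a sequence of degree sequences. Let $V$ be a finite vertex set with $n=|V|$ and $E$ a finite set of (labelled) hyperedges. A directed degree sequence consists of vertex out- and in-degrees $d_v^{\mathrm{out}},d_v^{\mathrm{in}}\in\mathbb{N}$ ($v\in V$) and hyperedge tail- and head-degrees $\delta_e^{\mathrm{tail}},\delta_e^{\mathrm{head}}\in\mathbb{N}$ ($e\in E$) with $\sum_v d_v^{\mathrm{out}}=\sum_e\delta_e^{\mathrm{tail}}$ and $\sum_v d_v^{\mathrm{in}}=\sum_e\delta_e^{\mathrm{head}}$. A uniformly random (stub-labeled) directed hypergraph with this degree sequence is obtained as follows: each vertex $v$ has $d_v^{\mathrm{out}}$ distinguishable out-stubs and $d_v^{\mathrm{in}}$ distinguishable in-stubs; all out-stubs are distributed over the tails so that the tail of $e$ receives exactly $\delta_e^{\mathrm{tail}}$ out-stubs, and all in-stubs are distributed over the heads so that the head of $e$ receives exactly $\delta_e^{\mathrm{head}}$ in-stubs (slots within a tail or head are interchangeable); all such pairs of assignments are equally likely (so the out- and in-assignments are independent and uniform). Each hyperedge is then a pair $e=(e^{\mathrm{tail}},e^{\mathrm{head}})$ of multisets of vertices, where multiplicities count the stubs of a vertex in the tail and in the head. Two distinct hyperedges $e_1,e_2$ form a multi-hyperedge pair if $e_1^{\mathrm{tail}}=e_2^{\mathrm{tail}}$ and $e_1^{\mathrm{head}}=e_2^{\mathrm{head}}$ as multisets; $M_n$ is the number of unordered multi-hyperedge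 pairs. $U$ is a uniformly chosen vertex of $V$, with out-degree $d_U^{\mathrm{out}}$ and in-degree $d_U^{\mathrm{in}}$. *)

(* Defs.v *)
From mathcomp Require Import all_boot all_order all_algebra.
From mathcomp Require Import finmap multiset.

Set Implicit Arguments.
Unset Strict Implicit.
Unset Printing Implicit Defensive.

Local Open Scope ring_scope.
Local Open Scope mset_scope.

Record degree_sequence (V E : finType) := DegreeSequence {
  dout : V -> nat;
  din : V -> nat;
  dtail : E -> nat;
  dhead : E -> nat;
  sum_dout : (\sum_(v : V) dout v = \sum_(e : E) dtail e)%N;
  sum_din : (\sum_(v : V) din v = \sum_(e : E) dhead e)%N }.

(* The second component distinguishes the [d v] stubs of the vertex [v]. *)
Definition stub (V : finType) (d : V -> nat) : finType := {v : V & 'I_(d v)}.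

(* A stub is mapped to the hyperedge receiving it, not to a slot within that
   hyperedge, because slots are interchangeable. *)
Definition assignments (V E : finType) (d : V -> nat) (delta : E -> nat) :
    {set {ffun stub d -> E}} :=
  [set f : {ffun stub d -> E} |
    [forall e : E, #|[set s : stub d | f s == e]| == delta e]].

Definition part (V E : finType) (d : V -> nat) (f : {ffun stub d -> E}) (e : E) :
    {mset V} :=
  seq_mset [seq tag s | s in [set s : stub d | f s == e]].

Section Hypergraphs.
Context (V E : finType) (D : degree_sequence V E).

Definition configuration : finType :=
  ({ffun stub (dout D) -> E} * {ffun stub (din D) -> E})%type.

Definition hypergraphs : {set configuration} :=
  setX (assignments (dout D) (dtail D)) (assignments (din D) (dhead D)).

Definition edge_tail (G : configuration) (e : E) : {mset V} := part G.1 e.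
Definition edge_head (G : configuration) (e : E) : {mset V} := part G.2 e.

Definition multi_pairs (G : configuration) : {set {set E}} :=
  [set [set e1; e2] | e1 in [set: E], e2 in [set: E] &
    [&& e1 != e2, edge_tail G e1 == edge_tail G e2 & edge_head G e1 == edge_head G e2]].

End Hypergraphs.

(* Expectation and probability under the uniform distribution on [A]; both are
   0 when [A] is empty. *)
Definition expect (R : fieldType) (T : finType) (A : {set T}) (X : T -> R) : R :=
  (\sum_(x in A) X x) / #|A|%:R.

Definition prob (R : fieldType) (T : finType) (A : {set T}) (P : pred T) : R :=
  #|[set x in A | P x]|%:R / #|A|%:R.

Arguments prob R {T} A P.

Definition expected_multi_pairs (R : fieldType) (V E : finType)
    (D : degree_sequence V E) : R :=
  expect (hypergraphs D) (fun G => #|multi_pairs G|%:R).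

(* The [k]-th moment of [d U] for a uniform vertex [U]. *)
Definition moment (R : fieldType) (V : finType) (d : V -> nat) (k : nat) : R :=
  expect [set: V] (fun v => (d v)%:R ^+ k).

(* Main.v *)
Require Import Defs.
From mathcomp Require Import all_boot all_order all_algebra.
From mathcomp Require Import fingroup perm action alt primitive_action.
From mathcomp Require Import finmap multiset zify ring lra.
Import Order.TTheory GRing.Theory Num.Theory.

(** By linearity, and because the out- and the in-stubs are assigned
    independently, twice the expected number of multi-hyperedge pairs is the
    sum, over ordered pairs of distinct hyperedges, of the probability that
    their tails coincide times the probability that their heads coincide
    ([expected_multi_pairsE]).  Everything rests on one such probability: that,
    in a uniform assignment of the stubs of a degree function [d] to hyperedges
    of size [k], two given hyperedges [e1] and [e2] receive the same multiset of
    vertices.  Write [s] for the sum of the [d v] and [x] for the sum of the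
    [d v * (d v - 1)], which counts the ordered pairs of distinct stubs of a
    common vertex.  The probability is close to [k! * (x / s ^ 2) ^ k].

    To see this, list the stubs received by [e1] and those received by [e2],
    side by side, as a sequence of [k] pairs of stubs (a pairing).
    The symmetric group on the stubs acts transitively on tuples of distinct
    stubs, so each pairing of distinct stubs lists the parts of [e1] and [e2]
    in the same number [N] of assignments ([sum_pairings]).  Counting assignments together
    with a pairing in two ways gives three relations.
    - Each assignment has [k! ^ 2] pairings, and there are [s ^_ (2 * k)]
      pairings of distinct stubs, which determines [N].
    - Call a pairing matched if each of its pairs has a common vertex.  If the
      parts of [e1] and [e2] coincide, every listing of the first is completed
      to a matched pairing by a listing of the second, so that there are at
      least [k!] matched pairings; there are at most [x ^ k] in all, whence an
      upper bound.
    - Call a matched pairing scattered if its [k] vertices are distinct.  Such a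
      pairing is determined by its first components, so that an assignment has
      at most [k!] of them, and none unless the parts coincide.  All but
      [k * (k - 1) * q * x ^ (k - 2)] of the sequences counted by [x ^ k] are
      scattered, where [q] is the sum of the [(d v * (d v - 1)) ^ 2].  Hence a
      lower bound.
    The relative errors are therefore at most [k * (k - 1) * q / x ^ 2] and
    [4 * k ^ 2 / s] ([coincidence_prob]).

    If a positive proportion of the vertices has degree at least [2 * k], then
    [s] and [x] are at least of order [n], and so is the number of hyperedges,
    whose number of ordered pairs is then equivalent to its square.  For
    [k >= 2] the sum [q] is at most the sum of the [d v ^ (2 * k)], which the
    moment hypothesis makes negligible against [n ^ 2] and so against [x ^ 2];
    for [k = 1] the corresponding error is zero ([relative_errors_small]).
    Rewriting [s] and [x] in terms of moments turns the estimate into the stated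
    formula ([main_term]). *)

Set Implicit Arguments.
Unset Strict Implicit.
Unset Printing Implicit Defensive.

(** * Finite combinatorics *)

(** The symmetric group acts [#|T|]-transitively on [T]: this is the symmetry
    that makes all tuples of distinct stubs equally likely. *)
Lemma perm_extends_injections (J T : finType) (c c' : J -> T) :
  injective c -> injective c' -> exists s : {perm T}, forall j, s (c j) = c' j.
Proof.
move=> c_inj c'_inj.
pose t (g : J -> T) := [tuple g (enum_val i) | i < #|J|].
have dt g : injective g -> t g \in #|J|.-dtuple([set: T]).
  move=> g_inj; apply/dtuple_onP; split=> [i1 i2|i]; last by rewrite inE.
  by rewrite !tnth_mktuple => /g_inj /enum_val_inj.
have le_JT : #|J| <= #|T| by rewrite -(card_codom c_inj) max_card.
have /imsetP[t0 _ orb] := ntransitive_weak le_JT (Sym_trans T).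
have := dt _ c_inj; have := dt _ c'_inj.
rewrite orb => /imsetP[s' _ Dc'] /imsetP[s _ Dc].
exists (s^-1 * s')%g => j.
move/(congr1 (fun u => tnth u (enum_rank j))): Dc.
move/(congr1 (fun u => tnth u (enum_rank j))): Dc'.
rewrite !tnth_map /= tnth_ord_tuple enum_rankK /aperm => -> ->.
by rewrite permM permK.
Qed.

Lemma pair_ffun_bij (I A B : finType) :
  bijective (fun w : {ffun I -> A * B} => ([ffun i => (w i).1], [ffun i => (w i).2])).
Proof.
exists (fun u : {ffun I -> A} * {ffun I -> B} => [ffun i => (u.1 i, u.2 i)]) => [w|[a b]].
  by apply/ffunP => i; rewrite !ffunE -surjective_pairing.
by congr (_, _); apply/ffunP => i; rewrite !ffunE.
Qed.

Lemma card_off_diagonal (T : finType) (A : {set T}) :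
  #|[set p in setX A A | p.1 != p.2]| = #|A| * #|A|.-1.
Proof.
have -> : [set p in setX A A | p.1 != p.2] = setX A A :\: [set (s, s) | s in A].
  apply/setP => -[s s']; rewrite !inE /= andbC.
  case: (boolP ((s \in A) && (s' \in A))) => [/andP[sA _]|]; rewrite ?andbF // !andbT.
  by congr negb; apply/eqP/imsetP => [<-|[? _ [-> ->]] //]; exists s.
rewrite cardsD (setIidPr _); last first.
  by apply/subsetP => _ /imsetP[s sA ->]; rewrite !inE sA.
rewrite cardsX card_imset; last by move=> s s' [].
by rewrite -subn1 mulnBr muln1.
Qed.

Lemma leq_card_bigcup (I T : finType) (P : pred I) (F : I -> {set T}) :
  #|\bigcup_(i | P i) F i| <= \sum_(i | P i) #|F i|.
Proof.
elim/big_rec2: _ => [|i n A _ leAn]; first by rewrite cards0.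
by rewrite (leq_trans (leq_card_setU _ _)) // leq_add2l.
Qed.

(** * Pairings of the stubs of two hyperedges *)

Section Assignments.
Variables (V E : finType) (d : V -> nat) (delta : E -> nat).
Local Notation T := (stub d).
Implicit Types (f : {ffun T -> E}) (e : E).

Lemma card_stub : #|{: T}| = \sum_v d v.
Proof.
rewrite card_tagged sumnE big_map big_enum /=.
by apply: eq_bigr => v _; rewrite card_ord.
Qed.

(** Matching the stubs with the slots of the hyperedges, of which there are as
    many, gives an assignment. *)
Lemma assignments_nonempty :
  \sum_v d v = \sum_e delta e -> assignments d delta != set0.
Proof.
move=> eq_sum; pose T' := {e : E & 'I_(delta e)}.
have cT' : #|{: T'}| = #|{: T}|.
  rewrite card_stub eq_sum card_tagged sumnE big_map big_enum /=.
  by apply: eq_bigr => e _; rewrite card_ord.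
pose g (s : T) : T' := enum_val (cast_ord (esym cT') (enum_rank s)).
pose h (s : T') : T := enum_val (cast_ord cT' (enum_rank s)).
have gK : cancel g h by move=> s; rewrite /g /h enum_valK cast_ordKV enum_rankK.
have hK : cancel h g by move=> s; rewrite /g /h enum_valK cast_ordK enum_rankK.
apply/set0Pn; exists [ffun s => tag (g s)]; rewrite inE; apply/forallP => e.
have -> : [set s | [ffun s0 => tag (g s0)] s == e]
          = [set h (Tagged (fun e => 'I_(delta e)) i) | i : 'I_(delta e)].
  apply/setP=> s; rewrite inE ffunE; apply/eqP/imsetP => [De|[i _ ->]]; last first.
    by rewrite hK.
  case Dg: (g s) De => [e' i] /= De; subst e'.
  by exists i => //; rewrite /Tagged -Dg gK.
rewrite card_imset ?card_ord // => i j /(can_inj hK) /eqP.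
by rewrite eq_Tagged => /eqP.
Qed.

(** Composition with a permutation of the stubs preserves assignments; one that
    carries [c] to [c'] exchanges the two sets. *)
Lemma card_prescribed (J : finType) (l : J -> E) (c c' : J -> T) :
  injective c -> injective c' ->
  #|[set f in assignments d delta | [forall j, f (c j) == l j]]|
  = #|[set f in assignments d delta | [forall j, f (c' j) == l j]]|.
Proof.
move=> c_inj c'_inj.
have [s Ds] := perm_extends_injections c_inj c'_inj.
pose comp (f : {ffun T -> E}) := [ffun x => f (s x)] : {ffun T -> E}.
have compI : bijective comp.
  exists (fun f : {ffun T -> E} => [ffun x => f (s^-1%g x)]) => f; apply/ffunP => x.
    by rewrite !ffunE permKV.
  by rewrite !ffunE permK.
rewrite -[LHS](on_card_preimset (f := comp)); last exact/onW_bij.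
apply: eq_card => f; rewrite !inE; congr (_ && _); apply: eq_forallb => x; last first.
  by rewrite ffunE Ds.
congr (_ == _); rewrite -[LHS](card_imset _ (@perm_inj _ s)).
apply: eq_card => y; rewrite inE; apply/imsetP/idP => [[z]|fy].
  by rewrite inE ffunE => fz ->.
by exists (s^-1%g y); rewrite ?inE ?ffunE permKV.
Qed.

Section Enumerations.
Variables (k : nat) (e1 e2 : E).
Hypothesis (neq_e : e1 != e2) (delta_k : forall e, delta e = k).

Definition enumerations f e : {set {ffun 'I_k -> T}} :=
  [set a in ffun_on [set s | f s == e] | injectiveb a].

Lemma card_enumerations f e :
  f \in assignments d delta -> #|enumerations f e| = k`!.
Proof.
rewrite inE => /forallP /(_ e) /eqP De.
by rewrite card_inj_ffuns_on De delta_k card_ord ffactnn.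
Qed.

Lemma enumerationsP f e (a : {ffun 'I_k -> T}) :
  reflect (injective a /\ forall i, f (a i) = e) (a \in enumerations f e).
Proof.
rewrite inE; apply: (iffP andP) => [[/ffun_onP fa /injectiveP a_inj]|[a_inj fa]].
  by split=> // i; have := fa i; rewrite inE => /eqP.
by split; [apply/ffun_onP => i; rewrite inE fa | apply/injectiveP].
Qed.

(** By cardinality, an injective listing of [k] of the stubs received by [e]
    lists them all. *)
Lemma enumerations_onto f e (a : {ffun 'I_k -> T}) s :
  f \in assignments d delta -> a \in enumerations f e -> f s = e ->
  exists i, s = a i.
Proof.
rewrite inE => /forallP /(_ e) /eqP De /enumerationsP[a_inj fa] fs.
have : [set a i | i : 'I_k] = [set s | f s == e].
  apply/eqP; rewrite eqEcard De delta_k card_imset // card_ord leqnn andbT.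
  by apply/subsetP => _ /imsetP[i _ ->]; rewrite inE fa.
move/setP/(_ s); rewrite !inE fs eqxx => /imsetP[i _ ->]; by exists i.
Qed.

Local Notation pairing := {ffun 'I_k -> T * T}.
Implicit Types w : pairing.

Definition left_stubs w : {ffun 'I_k -> T} := [ffun i => (w i).1].
Definition right_stubs w : {ffun 'I_k -> T} := [ffun i => (w i).2].
(** The [2 * k] stubs of a pairing as a single family, whose injectivity says
    that they are all distinct. *)
Definition joint w : {ffun 'I_k * bool -> T} :=
  [ffun j => if j.2 then (w j.1).1 else (w j.1).2].

Lemma joint_bij : bijective joint.
Proof.
exists (fun c : {ffun 'I_k * bool -> T} => [ffun i => (c (i, true), c (i, false))]).
  by move=> w; apply/ffunP => i; rewrite !ffunE -surjective_pairing.
by move=> c; apply/ffunP => -[i []]; rewrite !ffunE.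
Qed.

Definition pairings f : {set pairing} :=
  [set w | (left_stubs w \in enumerations f e1) && (right_stubs w \in enumerations f e2)].

Lemma card_pairings f : f \in assignments d delta -> #|pairings f| = k`! ^ 2.
Proof.
move=> fA; rewrite -mulnn -{1}(card_enumerations e1 fA) -(card_enumerations e2 fA).
rewrite -cardsX -[RHS](on_card_preimset (onW_bij _ (pair_ffun_bij _ _ _))).
by apply: eq_card => w; rewrite !inE.
Qed.

Lemma pairingsE f w :
  (w \in pairings f) =
  injectiveb (joint w) && [forall j, f (joint w j) == if j.2 then e1 else e2].
Proof.
rewrite inE; apply/andP/andP=> [[]|[/injectiveP w_inj /forallP fw]].
  move=> /enumerationsP[l_inj fl] /enumerationsP[r_inj fr]; split.
    apply/injectiveP => -[i1 [] [i2 []]]; rewrite !ffunE /= => eq12.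
    - by congr (_, _); apply: l_inj; rewrite !ffunE.
    - by move: (fl i1) (fr i2) neq_e; rewrite !ffunE eq12 => -> ->; rewrite eqxx.
    - by move: (fl i2) (fr i1) neq_e; rewrite !ffunE eq12 => -> ->; rewrite eqxx.
    - by congr (_, _); apply: r_inj; rewrite !ffunE.
  by apply/forallP => -[i []] /=; rewrite ffunE /=;
    move: (fl i) (fr i); rewrite !ffunE => flE frE; apply/eqP.
split; apply/enumerationsP; split.
- move=> i1 i2; rewrite !ffunE => eq12.
  suff [] : (i1, true) = (i2, true) by [].
  by apply: w_inj; rewrite !ffunE.
- by move=> i; have := fw (i, true); rewrite !ffunE => /eqP.
- move=> i1 i2; rewrite !ffunE => eq12.
  suff [] : (i1, false) = (i2, false) by [].
  by apply: w_inj; rewrite !ffunE.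
- by move=> i; have := fw (i, false); rewrite !ffunE => /eqP.
Qed.

(** The double counting: [N] is the number of assignments for which a given
    pairing of distinct stubs lists the parts of [e1] and [e2], and does not
    depend on the pairing by [card_prescribed]. *)
Lemma sum_pairings : exists N, forall Q : pred pairing,
  \sum_(f in assignments d delta) #|[set w in pairings f | Q w]|
  = N * #|[set w | injectiveb (joint w) && Q w]|.
Proof.
pose K w := #|[set f in assignments d delta |
                 [forall j, f (joint w j) == if j.2 then e1 else e2]]|.
have KE w w' : injectiveb (joint w) -> injectiveb (joint w') -> K w = K w'.
  by move=> /injectiveP ? /injectiveP ?; apply: card_prescribed.
have [N KN] : exists N, forall w, injectiveb (joint w) -> K w = N.
  (* With fewer than [2 * k] stubs there is no such pairing, and any [N] will do. *)
  case: (pickP (fun w => injectiveb (joint w))) => [w0 w0_inj|none].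
    by exists (K w0) => w w_inj; apply: KE.
  by exists 0 => w; rewrite none.
exists N => Q.
under eq_bigr => f _ do rewrite -sum1dep_card.
rewrite (exchange_big_dep (fun w => injectiveb (joint w) && Q w)) /=; last first.
  by move=> f w _; rewrite pairingsE => /andP[/andP[-> _] ->].
rewrite -sum1dep_card big_distrr /=; apply: eq_bigr => w /andP[w_inj Qw].
rewrite muln1 -(KN _ w_inj) sum1dep_card; apply: eq_card => f.
by rewrite [RHS]in_set in_set pairingsE Qw w_inj andbT.
Qed.

Definition matched w := [forall i, tag (w i).1 == tag (w i).2].
Definition scattered w := injectiveb (fun i => tag (w i).1).

(** Equality of the parts can be read on any enumerations of them, as equality
    of the vertex sequences up to reordering. *)
Lemma part_eqP f (a b : {ffun 'I_k -> T}) :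
  f \in assignments d delta ->
  a \in enumerations f e1 -> b \in enumerations f e2 ->
  reflect (part f e1 = part f e2)
    (perm_eq [seq tag (a i) | i : 'I_k] [seq tag (b i) | i : 'I_k]).
Proof.
have codomE e (c : {ffun 'I_k -> T}) : f \in assignments d delta ->
    c \in enumerations f e ->
    perm_eq [seq tag (c i) | i : 'I_k] [seq tag s | s in [set s : T | f s == e]].
  move=> fA cE; have -> : [seq tag (c i) | i : 'I_k] = map tag [seq c i | i : 'I_k].
    by rewrite -map_comp.
  apply: perm_map.
  have /enumerationsP[c_inj fc] := cE.
  apply: uniq_perm; rewrite ?enum_uniq ?map_inj_uniq -?enumT ?enum_uniq //.
  move=> s; rewrite mem_enum inE; apply/mapP/eqP => [[i _ ->]|fs]; first exact: fc.
  by have [i ->] := enumerations_onto fA cE fs; exists i; rewrite ?mem_enum.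
move=> fA aE bE; apply: (iffP idP) => [ab|].
  apply/eq_seq_msetP.
  by rewrite -(permPl (codomE _ _ fA aE)) -(permPr (codomE _ _ fA bE)).
move/eq_seq_msetP => ab.
by rewrite (permPl (codomE _ _ fA aE)) (permPr (codomE _ _ fA bE)).
Qed.

(** Each of the [k!] enumerations of the part of [e1] extends to a matched
    pairing, by reordering an enumeration of the part of [e2]. *)
Lemma leq_card_matched_pairings f :
  f \in assignments d delta -> part f e1 = part f e2 ->
  k`! <= #|[set w in pairings f | matched w]|.
Proof.
move=> fA eq_parts; rewrite -(card_enumerations e1 fA).
apply: leq_trans (leq_imset_card left_stubs _); apply/subset_leq_card/subsetP => a aE.
have [b0 b0E] : exists b0, b0 \in enumerations f e2.
  by apply/card_gt0P; rewrite card_enumerations // fact_gt0.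
have := elimT (part_eqP fA aE b0E); have /(introT (part_eqP fA aE b0E)) := eq_parts.
move=> ab0 _; have [p Dp] : exists p : 'S_k, forall i, tag (a i) = tag (b0 (p i)).
  have ab0' : perm_eq [tuple tag (a i) | i < k] [tuple tag (b0 i) | i < k].
    by rewrite /= -![map _ _]/(image _ _) in ab0 *.
  have /tuple_permP[p Dp] := ab0'; exists p => i.
  by move/(congr1 (fun s => nth (tag (a i)) s i)): Dp; rewrite -!tnth_nth !tnth_mktuple.
pose w := [ffun i => (a i, b0 (p i))] : pairing.
have -> : a = left_stubs w by apply/ffunP => i; rewrite !ffunE.
apply: imset_f; rewrite in_set; apply/andP; split; first (rewrite in_set; apply/andP; split).
- by have -> : left_stubs w = a by apply/ffunP => i; rewrite !ffunE.
- have /enumerationsP[b_inj fb] := b0E; apply/enumerationsP; split=> [i j|i].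
    by rewrite !ffunE => /b_inj /perm_inj.
  by rewrite !ffunE fb.
- by apply/forallP => i; rewrite ffunE Dp.
Qed.

(** When the vertices of the left stubs are distinct, the right stub matched
    with a left stub is the only one received by [e2] at that vertex; the
    left stubs thus determine the pairing. *)
Lemma card_scattered_pairings_leq f :
  f \in assignments d delta ->
  #|[set w in pairings f | matched w && scattered w]|
  <= (part f e1 == part f e2) * k`!.
Proof.
move=> fA; have [->|[w0]] := set_0Vmem [set w in pairings f | matched w && scattered w].
  by rewrite cards0.
have wP w : w \in [set w in pairings f | matched w && scattered w] ->
    [/\ left_stubs w \in enumerations f e1, right_stubs w \in enumerations f e2,
        forall i, tag (left_stubs w i) = tag (right_stubs w i)
      & injective (fun i => tag (left_stubs w i))].
  rewrite in_set => /andP[]; rewrite in_set => /andP[-> ->] /andP[/forallP wm /injectiveP ws].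
  split=> // [i|i j]; rewrite !ffunE; [exact/eqP/wm | exact: ws].
move=> /wP[l0 r0 m0 _].
have -> : part f e1 == part f e2.
  by apply/eqP/(part_eqP fA l0 r0); rewrite /image_mem (eq_map m0).
rewrite mul1n -(card_enumerations e1 fA).
have left_inj : {in [set w in pairings f | matched w && scattered w] &, injective left_stubs}.
  move=> w w' /wP[l r m s] /wP[l' r' m' s'] eq_l.
  apply/ffunP => i; have := congr1 (fun a : {ffun 'I_k -> T} => a i) eq_l.
  rewrite !ffunE => eq1; rewrite [w i]surjective_pairing [w' i]surjective_pairing eq1.
  congr (_, _).
  have /enumerationsP[_ /(_ i) fr'] := r'.
  have [j Dj] := enumerations_onto fA r fr'.
  have : tag (left_stubs w j) = tag (left_stubs w i) by rewrite m -Dj -m' eq_l.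
  by move/s => Dji; move: Dj; rewrite Dji !ffunE.
rewrite -(card_in_imset left_inj); apply/subset_leq_card/subsetP => _ /imsetP[w /wP[? _ _ _] ->].
by [].
Qed.

Lemma card_joint_injective :
  #|[set w : pairing | injectiveb (joint w)]| = (\sum_v d v) ^_ (2 * k).
Proof.
have := card_inj_ffuns ('I_k * bool)%type T.
rewrite card_prod card_ord card_bool card_stub [k * 2]mulnC => <-.
rewrite -[RHS](on_card_preimset (onW_bij _ joint_bij)).
by apply: eq_card => w; rewrite !inE.
Qed.

Definition twins_at v : {set T * T} :=
  [set p in setX [set s | tag s == v] [set s | tag s == v] | p.1 != p.2].
Definition twins : {set T * T} := [set p | (tag p.1 == tag p.2) && (p.1 != p.2)].

Lemma card_twins_at v : #|twins_at v| = d v * (d v).-1.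
Proof.
rewrite card_off_diagonal.
have -> : [set s : T | tag s == v] = [set Tagged (fun v => 'I_(d v)) i | i : 'I_(d v)].
  apply/setP => -[v' i]; rewrite inE /=.
  apply/eqP/imsetP => [ev|[j _ /(congr1 (fun s : T => tag s))] //].
  by subst v'; exists i.
by rewrite card_imset ?card_ord // => i j /eqP; rewrite eq_Tagged => /eqP.
Qed.

Lemma card_twins : #|twins| = \sum_v d v * (d v).-1.
Proof.
rewrite -sum1_card (partition_big (fun p : T * T => tag p.1) predT) //=.
apply: eq_bigr => v _; rewrite -card_twins_at sum1dep_card; apply: eq_card => -[s s'].
rewrite !inE /=; have [<-|nv] := eqVneq (tag s) v; last by rewrite andbF.
  by rewrite andbT eq_sym.
Qed.

Lemma card_matched_leq :
  #|[set w : pairing | injectiveb (joint w) && matched w]|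
  <= (\sum_v d v * (d v).-1) ^ k.
Proof.
rewrite -card_twins -[X in _ ^ X](card_ord k) -(card_ffun_on _ twins).
apply/subset_leq_card/subsetP => w; rewrite inE => /andP[/injectiveP w_inj /forallP wm].
apply/ffun_onP => i; rewrite inE wm /=; apply/eqP => eq12.
by have := w_inj (i, true) (i, false); rewrite !ffunE eq12 => /(_ erefl).
Qed.

(** Union bound: a sequence of [k] pairs of twins that is not scattered has two
    pairs, at distinct positions [i] and [j], with a common vertex [v].  Given
    [i], [j] and [v], these two pairs are chosen in [(d v * (d v).-1) ^ 2] ways
    and each of the [k - 2] others in [\sum_v d v * (d v).-1] ways.  For
    [k < 2] the truncated exponent is harmless, as [k * k.-1] vanishes. *)
Lemma card_scattered_geq :
  (\sum_v d v * (d v).-1) ^ k <=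
  #|[set w : pairing | injectiveb (joint w) && (matched w && scattered w)]| +
  k * k.-1 * (\sum_v (d v * (d v).-1) ^ 2) * (\sum_v d v * (d v).-1) ^ (k - 2).
Proof.
set W := [set w | _]; set X := \sum_v d v * _.
pose off := [set p in setX [set: 'I_k] [set: 'I_k] | p.1 != p.2].
(* [setXn (F (i, j, v))] contains the sequences of twins whose pairs at the
   positions [i] and [j] are both at [v]. *)
pose F (q : 'I_k * 'I_k * V) (l : 'I_k) :=
  if (l == q.1.1) || (l == q.1.2) then twins_at q.2 else twins.
pose B := \bigcup_(q in setX off [set: V]) setXn (F q).
have sub : [set w in ffun_on twins] \subset W :|: B.
  apply/subsetP => w; rewrite inE => /ffun_onP wt.
  have wtE i : tag (w i).1 = tag (w i).2 /\ (w i).1 != (w i).2.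
    by have := wt i; rewrite inE => /andP[/eqP].
  rewrite inE; have [sw|/injectivePn[i [j neq_ij eq_tag]]] := boolP (scattered w).
    apply/orP; left; rewrite inE sw andbT; apply/andP; split; last first.
      by apply/forallP => i; apply/eqP; case: (wtE i).
    apply/injectiveP => -[i b] [j b'] eq_ij.
    have Dij : i = j.
      apply: (injectiveP _ sw); move: eq_ij; rewrite !ffunE /=.
      by case: b; case: b' => /(congr1 (fun s : T => tag s)); rewrite -?(wtE i).1 -?(wtE j).1.
    subst j; congr (_, _); move: eq_ij (wtE i).2; rewrite !ffunE /=.
    by case: b; case: b' => // ->; rewrite eqxx.
  apply/orP; right; apply/bigcupP; exists ((i, j), tag (w i).1); first by rewrite !inE /= neq_ij.
  apply/setXnP => l; rewrite /F /=; case: ifP => // /orP[]/eqP ->.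
    by rewrite !inE -(wtE i).1 eqxx (wtE i).2.
  by rewrite !inE -(wtE j).1 -eq_tag eqxx (wtE j).2.
have -> : X ^ k = #|[set w : pairing in ffun_on twins]|.
  by rewrite cardsE card_ffun_on card_ord card_twins.
apply: leq_trans (subset_leq_card sub) _.
apply: leq_trans (leq_card_setU _ _) _; rewrite leq_add2l.
apply: leq_trans (leq_card_bigcup _ _) _.
have cF i j v : i != j -> #|setXn (F ((i, j), v))| = (d v * (d v).-1) ^ 2 * X ^ (k - 2).
  move=> neq_ij; rewrite cardsXn (bigD1 i) //= (bigD1 j) 1?eq_sym //=.
  rewrite {1 2}/F /= !eqxx orbT /= card_twins_at mulnA mulnn; congr (_ * _).
  rewrite (eq_bigr (fun=> X)) => [|l /andP[/negPf li /negPf lj]]; last first.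
    by rewrite /F /= li lj card_twins.
  rewrite prod_nat_const; congr (_ ^ _).
  rewrite -[k in RHS]card_ord -(cardC (pred2 i j)) card2 neq_ij addKn.
  by apply: eq_card => l; rewrite !inE negb_or.
rewrite (eq_bigr (fun q => (d q.2 * (d q.2).-1) ^ 2 * X ^ (k - 2))); last first.
  by move=> [[i j] v]; rewrite in_setX in_set /= => /andP[/andP[_ ij] _]; exact: cF.
rewrite (eq_bigl (fun q => (q.1 \in off) && predT q.2)); last first.
  by move=> q; rewrite !inE andbT.
rewrite -(pair_big (mem off) predT (fun _ v => (d v * (d v).-1) ^ 2 * X ^ (k - 2))) /=.
rewrite sum_nat_const -big_distrl /=.
by rewrite card_off_diagonal cardsT card_ord mulnA.
Qed.

(** Eliminating [N] between the three relations given by [sum_pairings]. *)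
Lemma card_parts_eq_bounds :
  let p := #|[set f in assignments d delta | part f e1 == part f e2]| in
  let A := #|assignments d delta| in
  let X := \sum_v d v * (d v).-1 in
  p * (\sum_v d v) ^_ (2 * k) <= A * k`! * X ^ k /\
  A * k`! * X ^ k <= p * (\sum_v d v) ^_ (2 * k) +
    A * k`! * (k * k.-1 * (\sum_v (d v * (d v).-1) ^ 2) * X ^ (k - 2)).
Proof.
move=> p A X; have [N sumN] := sum_pairings.
have AN : A * k`! ^ 2 = N * (\sum_v d v) ^_ (2 * k).
  rewrite -card_joint_injective; have := sumN predT.
  under eq_bigr => f fA.
    rewrite (_ : [set w in pairings f | predT w] = pairings f); last first.
      by apply/setP => w; rewrite in_set andbT.
    rewrite card_pairings //; over.
  rewrite sum_nat_const => ->; congr (_ * _); apply: eq_card => w.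
  by rewrite !inE andbT.
have k_gt0 : 0 < k`! by exact: fact_gt0.
have up : p * k`! <= N * X ^ k.
  apply: leq_trans (leq_mul (leqnn N) card_matched_leq); rewrite -sumN.
  rewrite /p -sum1dep_card big_distrl /= big_mkcondr /=; apply: leq_sum => f fA.
  by case: eqP => // eq_f; rewrite mul1n; apply: leq_card_matched_pairings.
set W := #|[set w : pairing | injectiveb (joint w) && (matched w && scattered w)]|.
have low : N * W <= p * k`!.
  rewrite -sumN /p -sum1dep_card big_distrl /= big_mkcondr /=; apply: leq_sum => f fA.
  apply: leq_trans (card_scattered_pairings_leq fA) _.
  by case: eqP.
have := card_scattered_geq; rewrite -/W -/X.
move: ((\sum_v d v) ^_ (2 * k)) (k * _ * _ * _) AN => S' Y AN lowW.
split; rewrite -(leq_pmul2r k_gt0).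
  have := leq_mul (leqnn S') up; nia.
have := leq_mul (leqnn S') low; nia.
Qed.

End Enumerations.
End Assignments.

(** * Counting multi-hyperedge pairs *)

(** Each unordered pair comes from exactly two ordered ones. *)
Lemma card_unordered_pairs (E : finType) (r : rel E) :
  symmetric r -> irreflexive r ->
  2 * #|[set [set e1; e2] | e1 in [set: E], e2 in [set: E] & r e1 e2]|
  = #|[set q : E * E | r q.1 q.2]|.
Proof.
move=> r_sym r_irr; set M := [set _ | _ in _, _ in _ & _].
rewrite -[RHS]sum1_card (partition_big (fun q : E * E => [set q.1; q.2]) (mem M)) /=.
  rewrite (eq_bigr (fun=> 2)) ?sum_nat_const 1?mulnC //.
  move=> A /imset2P[e1 e2 _]; rewrite !inE /= => r12 ->.
  have neq12 : e1 != e2 by apply: contraTneq r12 => ->; rewrite r_irr.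
  have <- : #|[set (e1, e2); (e2, e1)]| = 2 by rewrite cards2 xpair_eqE negb_and neq12.
  rewrite sum1dep_card; apply: eq_card => -[a b]; rewrite !inE !xpair_eqE /=.
  apply/andP/orP => [[rab /eqP/setP Dab]|].
    have neqab : a != b by apply: contraTneq rab => ->; rewrite r_irr.
    move: (Dab a) (Dab b); rewrite !inE !eqxx orbT /= => /esym/orP[]/eqP Da /esym/orP[]/eqP Db;
      subst a b; rewrite ?eqxx in neqab *; by [left|right|].
  case=> /andP[/eqP-> /eqP->]; first by rewrite r12 eqxx.
  by rewrite r_sym r12 [X in X == _]setUC eqxx.
move=> [a b]; rewrite !inE /= => rab; apply/imset2P; exists a b => //; by rewrite !inE.
Qed.

Section Expectation.
Variables (V E : finType) (D : degree_sequence V E).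

Definition equal_tails (q : E * E) : {set {ffun stub (dout D) -> E}} :=
  [set f in assignments (dout D) (dtail D) | part f q.1 == part f q.2].
Definition equal_heads (q : E * E) : {set {ffun stub (din D) -> E}} :=
  [set f in assignments (din D) (dhead D) | part f q.1 == part f q.2].

(** Exchanging the sums over hypergraphs and over pairs of hyperedges; for a
    fixed pair, the tail and head conditions bear on the two independent
    assignments. *)
Lemma sum_multi_pairs :
  2 * \sum_(G in hypergraphs D) #|multi_pairs G|
  = \sum_(q : E * E | q.1 != q.2) #|equal_tails q| * #|equal_heads q|.
Proof.
rewrite big_distrr /=.
pose eqG (G : configuration D) (q : E * E) :=
  (edge_tail G q.1 == edge_tail G q.2) && (edge_head G q.1 == edge_head G q.2).
under eq_bigr => G _.
  rewrite (@card_unordered_pairs _ (fun e1 e2 => (e1 != e2) && eqG G (e1, e2))); last first.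
  - by move=> e; rewrite eqxx.
  - by move=> e1 e2; rewrite /eqG /= eq_sym; congr [&& _, _ & _]; rewrite eq_sym.
  rewrite -sum1dep_card big_mkcondr /=; over.
rewrite exchange_big /=; apply: eq_bigr => q _.
rewrite -cardsX -big_mkcondr /= -sum1_card; apply: eq_bigl => -[f g].
by rewrite /eqG !inE /= -!andbA; do !bool_congr.
Qed.

End Expectation.

Local Open Scope ring_scope.

Section Bounds.
Variable R : realFieldType.

(** The lower bound is the induction [(1 - k ^ 2 / S) * (1 - k / S) >=
    1 - (k + 1) ^ 2 / S]. *)
Lemma ffact_real_bounds (S k : nat) : (0 < S)%N ->
  (S ^_ k)%:R <= S%:R ^+ k :> R /\
  S%:R ^+ k * (1 - k%:R ^+ 2 / S%:R) <= (S ^_ k)%:R :> R.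
Proof.
move=> S_gt0; have S0 : 0 < S%:R :> R by rewrite ltr0n.
elim: k => [|k [IHu IHl]]; first by rewrite ffactn0 !expr0 expr0n mul0r subr0 mulr1.
rewrite ffactnSr natrM [S%:R ^+ k.+1]exprSr; split.
  by apply: ler_pM => //; rewrite ler_nat leq_subr.
have [le_kS|lt_Sk] := leqP k S; last first.
  apply: (@le_trans _ _ 0); last by rewrite -natrM ler0n.
  rewrite mulr_ge0_le0 ?mulr_ge0 ?exprn_ge0 ?(ltW S0) //.
  rewrite -natrX subr_le0 ler_pdivlMr // mul1r ler_nat.
  by rewrite (leq_trans (ltnW (leqW lt_Sk))) // -mulnn leq_pmulr.
have Sk0 : 0 <= (S - k)%:R :> R by rewrite ler0n.
apply: le_trans (ler_wpM2r Sk0 IHl).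
rewrite -!mulrA ler_pM2l ?exprn_gt0 //.
rewrite natrB // -natr1.
have -> : S%:R * (1 - (k%:R + 1) * ((k%:R + 1) / S%:R)) = S%:R - (k%:R + 1) ^+ 2 :> R.
  by field; rewrite gt_eqF.
have -> : (1 - k%:R * (k%:R / S%:R)) * (S%:R - k%:R) =
          S%:R - k%:R - k%:R ^+ 2 + k%:R ^+ 3 / S%:R :> R.
  by field; rewrite gt_eqF.
have k0 : 0 <= k%:R :> R by rewrite ler0n.
have : 0 <= k%:R ^+ 3 / S%:R :> R by rewrite divr_ge0 ?exprn_ge0 // ltW.
move: (k%:R ^+ 3 / S%:R : R) => t; nra.
Qed.

(** The bounds of [card_parts_eq_bounds] in relative form: [p / A] is the
    probability that two given parts coincide, [S] the number of stubs, and [X]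
    and [Q] the sums of the [d v * (d v - 1)] and of their squares. *)
Lemma coincidence_bounds (p A S X Q k : nat) :
  (0 < k)%N -> (0 < A)%N -> (0 < S)%N -> (0 < X)%N ->
  (p * S ^_ (2 * k) <= A * k`! * X ^ k)%N ->
  (A * k`! * X ^ k <= p * S ^_ (2 * k) + A * k`! * (k * k.-1 * Q * X ^ (k - 2)))%N ->
  let main := k`!%:R * (X%:R / S%:R ^+ 2) ^+ k : R in
  main * (1 - (k * k.-1 * Q)%:R / X%:R ^+ 2) <= p%:R / A%:R /\
  p%:R / A%:R * (1 - (2 * k)%:R ^+ 2 / S%:R) <= main.
Proof.
move=> k0 A0 S0 X0 up low main.
have A0' : 0 < A%:R :> R by rewrite ltr0n.
have X0' : 0 < X%:R :> R by rewrite ltr0n.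
have S0' : 0 < S%:R :> R by rewrite ltr0n.
have F0' : 0 < k`!%:R :> R by rewrite ltr0n fact_gt0.
have [fu fl] := ffact_real_bounds (2 * k) S0.
have S2k : 0 < S%:R ^+ (2 * k) :> R by rewrite exprn_gt0.
have mainE : main * S%:R ^+ (2 * k) = k`!%:R * X%:R ^+ k.
  rewrite /main expr_div_n -exprM -mulrA divfK //; by rewrite gt_eqF.
have p0 : 0 <= p%:R :> R by rewrite ler0n.
split.
  rewrite ler_pdivlMr // -(ler_pM2r S2k).
  apply: (@le_trans _ _ (p%:R * (S ^_ (2 * k))%:R)); last exact: ler_wpM2l.
  set a := (_ / X%:R ^+ 2).
  have -> : main * (1 - a) * A%:R * S%:R ^+ (2 * k) = main * S%:R ^+ (2 * k) * (A%:R * (1 - a)).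
    by ring.
  rewrite mainE /a {a}.
  have : (A * k`! * X ^ k)%:R <= (p * S ^_ (2 * k) + A * k`! * (k * k.-1 * Q * X ^ (k - 2)))%:R :> R.
    by rewrite ler_nat.
  have XE : (k * k.-1 * Q * X ^ (k - 2))%:R = (k * k.-1 * Q)%:R * X%:R ^+ k / X%:R ^+ 2 :> R.
    case: k k0 {up low main mainE fu fl S2k F0'} => [//|[|k]] _; first by rewrite muln0 !mul0n !mul0r.
    rewrite subn2 natrM natrX /=.
    have -> : X%:R ^+ k.+2 = X%:R ^+ k * X%:R ^+ 2 :> R by rewrite -exprD addn2.
    rewrite mulrA mulfK //.
    by rewrite expf_neq0 // gt_eqF.
  rewrite natrD [(A * k`! * (_ * _))%:R]natrM XE [(p * _)%:R]natrM [(A * k`! * _)%:R]natrM [(A * k`!)%:R]natrM natrX -lerBlDr.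
  by apply: le_trans; rewrite le_eqVlt; apply/orP; left; apply/eqP; ring.
rewrite -(ler_pM2r S2k) mainE; set b := (_ / S%:R).
have -> : p%:R / A%:R * (1 - b) * S%:R ^+ (2 * k) = p%:R * (S%:R ^+ (2 * k) * (1 - b)) / A%:R.
  by ring.
rewrite ler_pdivrMr //.
apply: (@le_trans _ _ (p%:R * (S ^_ (2 * k))%:R)); first exact: ler_wpM2l.
by rewrite [_ * A%:R]mulrC mulrA -natrX -!natrM ler_nat.
Qed.
End Bounds.

(** * Bounds for a fixed degree sequence *)

Section Degrees.
Variables (V : finType) (d : V -> nat).
Definition stubs_total : nat := (\sum_v d v)%N.
(** The number of ordered pairs of distinct stubs of a common vertex. *)
Definition twins_total : nat := (\sum_v d v * (d v).-1)%N.
Definition twins_square : nat := (\sum_v (d v * (d v).-1) ^ 2)%N.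
End Degrees.

Section Finite.
Variable R : realFieldType.

Definition coincidence_estimate (V : finType) (d : V -> nat) (k : nat) : R :=
  k`!%:R * ((twins_total d)%:R / (stubs_total d)%:R ^+ 2) ^+ k.

(** The two relative errors of the estimate, from the pairings that are not
    scattered and from the falling factorial [s ^_ (2 * k)]. *)
Definition relative_errors_leq (V : finType) (d : V -> nat) (k : nat) (h : R) : Prop :=
  [/\ (0 < stubs_total d)%N, (0 < twins_total d)%N,
      (k * k.-1 * twins_square d)%:R / (twins_total d)%:R ^+ 2 <= h
    & (2 * k)%:R ^+ 2 / (stubs_total d)%:R <= h].

Lemma coincidence_gt0 (V : finType) (d : V -> nat) k :
  (0 < stubs_total d)%N -> (0 < twins_total d)%N -> 0 < coincidence_estimate d k.
Proof.
move=> s0 t0; rewrite /coincidence_estimate mulr_gt0 ?ltr0n ?fact_gt0 // exprn_gt0 //.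
by rewrite divr_gt0 ?exprn_gt0 ?ltr0n.
Qed.

Lemma coincidence_prob (V E : finType) (d : V -> nat) (delta : E -> nat) k e1 e2 h :
  (\sum_v d v = \sum_e delta e)%N -> (forall e, delta e = k) -> (0 < k)%N ->
  e1 != e2 -> relative_errors_leq d k h ->
  let p : R := #|[set f in assignments d delta | part f e1 == part f e2]|%:R
               / #|assignments d delta|%:R in
  coincidence_estimate d k * (1 - h) <= p /\ p * (1 - h) <= coincidence_estimate d k.
Proof.
move=> eq_sum delta_k k0 neq_e [s0 t0 ha hb] p.
have A0 : (0 < #|assignments d delta|)%N by rewrite card_gt0 assignments_nonempty.
have [up low] := card_parts_eq_bounds d neq_e delta_k.
have [L U] := coincidence_bounds R k0 A0 s0 t0 up low.
split; [apply: le_trans L | apply: le_trans U].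
  by rewrite ler_pM2l ?coincidence_gt0 // lerB.
by apply: ler_wpM2l; rewrite ?divr_ge0 // lerB.
Qed.

Lemma expected_multi_pairsE (V E : finType) (D : degree_sequence V E) :
  expected_multi_pairs R D =
  2^-1 * \sum_(q : E * E | q.1 != q.2)
    (#|equal_tails D q|%:R / #|assignments (dout D) (dtail D)|%:R) *
    (#|equal_heads D q|%:R / #|assignments (din D) (dhead D)|%:R).
Proof.
rewrite /expected_multi_pairs /expect -natr_sum cardsX.
under [in RHS]eq_bigr => q _ do rewrite mulrACA -invfM -!natrM.
rewrite -mulr_suml -natr_sum -sum_multi_pairs [(2 * _)%:R]natrM mulrA mulrA mulVf ?mul1r //.
by rewrite pnatr_eq0.
Qed.

(** The ratio lies between [(1 - h) ^+ 3] and [(1 - h) ^- 2]: one factor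
    [1 - h] for each of the two probabilities, and one in the lower bound for
    the [#|E| * (#|E| - 1)] ordered pairs against [#|E| ^ 2].  Both ends are
    within [8 * h] of [1] as soon as [h <= 1 / 4]. *)
Lemma expected_multi_pairs_bounds (V E : finType) (D : degree_sequence V E)
    (kt kh : nat) (h : R) :
  (forall e, dtail D e = kt) -> (forall e, dhead D e = kh) ->
  (0 < kt)%N -> (0 < kh)%N -> h <= 4^-1 ->
  relative_errors_leq (dout D) kt h -> relative_errors_leq (din D) kh h ->
  (0 < #|E|)%N -> #|E|%:R^-1 <= h ->
  `|expected_multi_pairs R D /
     (#|E|%:R ^+ 2 / 2 * coincidence_estimate (dout D) kt * coincidence_estimate (din D) kh) - 1| <= 8 * h.
Proof.
move=> ht hh kt0 kh0 h4 errt errh E0 hE; set main := (_ * coincidence_estimate (din D) kh).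
have [st0 tt0 _ _] := errt; have [sh0 th0 _ _] := errh.
have ct0 := coincidence_gt0 kt st0 tt0; have ch0 := coincidence_gt0 kh sh0 th0.
have m0 : 0 < #|E|%:R :> R by rewrite ltr0n.
have h0 : 0 <= h by apply: le_trans hE; rewrite invr_ge0 ltW.
have main0 : 0 < main by rewrite /main; do !apply: mulr_gt0 => //; rewrite ?exprn_gt0 ?invr_gt0 ?ltr0n.
have card_q : #|[pred q : E * E | q.1 != q.2]| = (#|E| * #|E|.-1)%N.
  rewrite -cardsT -card_off_diagonal; apply: eq_card => q; by rewrite !inE.
set ct := coincidence_estimate (dout D) kt in ct0 main main0 *.
set ch := coincidence_estimate (din D) kh in ch0 main main0 *.
have half0 : 0 <= 2^-1 :> R by rewrite invr_ge0 ler0n.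
pose c := ct * ch.
have c0 : 0 < c by rewrite mulr_gt0.
have mE : (#|E| * #|E|.-1)%:R = #|E|%:R ^+ 2 * (1 - #|E|%:R^-1) :> R.
  by rewrite natrM -subn1 natrB //; field; rewrite gt_eqF.
have qP q : q.1 != q.2 ->
    let x := (#|equal_tails D q|%:R / #|assignments (dout D) (dtail D)|%:R) *
      (#|equal_heads D q|%:R / #|assignments (din D) (dhead D)|%:R) : R in
    c * (1 - h) ^+ 2 <= x /\ x * (1 - h) ^+ 2 <= c.
  move=> neq_q; have [Lt Ut] := coincidence_prob (sum_dout D) ht kt0 neq_q errt.
  have [Lh Uh] := coincidence_prob (sum_din D) hh kh0 neq_q errh.
  rewrite /equal_tails /equal_heads -/ct -/ch in Lt Ut Lh Uh *.
  have h1 : 0 <= 1 - h by lra.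
  rewrite /c; split; rewrite expr2 mulrACA.
    by apply: ler_pM => //; rewrite mulr_ge0 // ltW.
  by apply: ler_pM => //; rewrite mulr_ge0 // divr_ge0.
have low : main * (1 - h) ^+ 3 <= expected_multi_pairs R D.
  rewrite expected_multi_pairsE.
  apply: (@le_trans _ _ (2^-1 * \sum_(q : E * E | q.1 != q.2) c * (1 - h) ^+ 2)).
    rewrite sumr_const card_q -[_ *+ (_ * _)]mulr_natl mE.
    rewrite /main -[_ * ct * ch]mulrA -/c [(1 - h) ^+ 3]exprS.
    have -> : #|E|%:R ^+ 2 / 2 * c * ((1 - h) * (1 - h) ^+ 2) =
       2^-1 * (#|E|%:R ^+ 2 * (1 - h) * (c * (1 - h) ^+ 2)) by ring.
    apply: ler_wpM2l => //; apply: ler_wpM2r; first by rewrite mulr_ge0 ?sqr_ge0 // ltW.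
    by apply: ler_wpM2l; rewrite ?sqr_ge0 // lerB.
  apply: ler_wpM2l => //; apply: ler_sum => q /qP[]; done.
have up : expected_multi_pairs R D * (1 - h) ^+ 2 <= main.
  rewrite expected_multi_pairsE -mulrA mulr_suml.
  apply: (@le_trans _ _ (2^-1 * \sum_(q : E * E | q.1 != q.2) c)).
    apply: ler_wpM2l => //; apply: ler_sum => q /qP[]; done.
  rewrite sumr_const card_q -[_ *+ (_ * _)]mulr_natl mE.
  have -> : main = 2^-1 * (#|E|%:R ^+ 2 * 1 * c) by rewrite /main /c; ring.
  apply: ler_wpM2l => //; apply: ler_wpM2r; first exact: ltW.
  by apply: ler_wpM2l; rewrite ?sqr_ge0 // gerBl invr_ge0 ltW.
pose y := expected_multi_pairs R D / main.
have ylow : (1 - h) ^+ 3 <= y by rewrite /y ler_pdivlMr // mulrC.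
have yup : y * (1 - h) ^+ 2 <= 1 by rewrite /y mulrAC ler_pdivrMr // mul1r.
rewrite -/y ler_norml; apply/andP; split; first by nra.
rewrite lerBlDr leNgt; apply/negP => ylt.
suff : 1 < y * (1 - h) ^+ 2 by rewrite ltNge yup.
apply: (@le_lt_trans _ _ ((8 * h + 1) * (1 - h) ^+ 2)); first by nra.
by rewrite ltr_pM2r // exprn_gt0 //; lra.
Qed.

Lemma momentE (V : finType) (d : V -> nat) j :
  (0 < #|V|)%N -> #|V|%:R * moment R d j = (\sum_v d v ^ j)%:R.
Proof.
move=> V0; rewrite /moment /expect cardsT mulrC divfK ?pnatr_eq0 -?lt0n //.
by rewrite natr_sum; apply: eq_big => [v|v _]; rewrite ?inE ?natrX.
Qed.

(** The factor [(k - 1)!] of the formula is [k! / k]: the [1 / k] turns the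
    number [n * moment d 1] of stubs into the number of hyperedges. *)
Lemma main_term (V E : finType) (D : degree_sequence V E) (kt kh : nat) :
  (forall e, dtail D e = kt) -> (forall e, dhead D e = kh) ->
  (0 < kt)%N -> (0 < kh)%N -> (0 < #|V|)%N ->
  (0 < stubs_total (dout D))%N -> (0 < stubs_total (din D))%N ->
  #|E|%:R ^+ 2 / 2 * coincidence_estimate (dout D) kt * coincidence_estimate (din D) kh =
  (kt.-1)`!%:R * (kh.-1)`!%:R / 2 * #|V|%:R ^+ 2
      * moment R (dout D) 1 * moment R (din D) 1
      * ((moment R (dout D) 2 - moment R (dout D) 1) / (#|V|%:R * moment R (dout D) 1 ^+ 2)) ^+ kt
      * ((moment R (din D) 2 - moment R (din D) 1) / (#|V|%:R * moment R (din D) 1 ^+ 2)) ^+ kh.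
Proof.
move=> ht hh kt0 kh0 V0 st0 sh0.
have n0 : #|V|%:R != 0 :> R by rewrite pnatr_eq0 -lt0n.
have m1 (d : V -> nat) : (stubs_total d)%:R = #|V|%:R * moment R d 1.
  by rewrite momentE //; congr _%:R; apply: eq_bigr => v _; rewrite expn1.
have m2 (d : V -> nat) : (twins_total d)%:R = #|V|%:R * (moment R d 2 - moment R d 1).
  rewrite mulrBr -m1 momentE // -natrB; last first.
    by apply: leq_sum => v _; case: (d v) => // x; rewrite -mulnn leq_pmulr.
  congr _%:R; apply/eqP; rewrite -(eqn_add2r (stubs_total d)) subnK; last first.
    by apply: leq_sum => v _; case: (d v) => // x; rewrite -mulnn leq_pmulr.
  rewrite -big_split /=; apply/eqP; apply: eq_bigr => v _.
  by case: (d v) => // x; rewrite -mulnn /= mulnS addnC.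
have factE k (x : R) : (0 < k)%N -> k`!%:R * x ^+ k = k%:R * (k.-1)`!%:R * x ^+ k.
  by case: k => // k _; rewrite factS natrM.
rewrite /coincidence_estimate !factE // !m2 (m1 (dout D)) (m1 (din D)).
have Et : #|E|%:R * kt%:R = #|V|%:R * moment R (dout D) 1.
  rewrite -m1 -natrM /stubs_total (sum_dout D); congr _%:R.
  by rewrite (eq_bigr (fun=> kt)) ?sum_nat_const // => e _; exact: ht.
have Eh : #|E|%:R * kh%:R = #|V|%:R * moment R (din D) 1.
  rewrite -m1 -natrM /stubs_total (sum_din D); congr _%:R.
  by rewrite (eq_bigr (fun=> kh)) ?sum_nat_const // => e _; exact: hh.
have st : moment R (dout D) 1 != 0.
  have : (stubs_total (dout D))%:R != 0 :> R by rewrite pnatr_eq0 -lt0n.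
  by rewrite m1 mulf_eq0 negb_or => /andP[].
have sh : moment R (din D) 1 != 0.
  have : (stubs_total (din D))%:R != 0 :> R by rewrite pnatr_eq0 -lt0n.
  by rewrite m1 mulf_eq0 negb_or => /andP[].
have redu (x y : R) : x != 0 -> #|V|%:R * y / (#|V|%:R * x) ^+ 2 = y / (#|V|%:R * x ^+ 2).
  by move=> x0; field; rewrite n0 x0.
rewrite !redu //.
move: (_ ^+ kt) (_ ^+ kh) => p q.
transitivity ((#|E|%:R * kt%:R) * (#|E|%:R * kh%:R) / 2 * ((kt.-1)`!%:R * p) * ((kh.-1)`!%:R * q)).
  by ring.
by rewrite Et Eh; ring.
Qed.

End Finite.

(** * Hyperedges and errors in terms of moments *)

(** Markov-type bound, used with [g] the identity and with
    [g j = j * (j - 1)], for which the sum counts stubs and pairs of twins. *)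
Lemma many_large_degrees (R : realFieldType) (V : finType) (d : V -> nat) (k : nat) (c : R)
    (g : nat -> nat) (x : nat) :
  (0 < #|V|)%N -> c <= prob R [set: V]%SET (fun v => (k <= d v)%N) ->
  (forall j, (k <= j)%N -> (x <= g j)%N) ->
  c * #|V|%:R * x%:R <= (\sum_v g (d v))%:R.
Proof.
move=> V0; rewrite /prob cardsT ler_pdivlMr ?ltr0n // => cP gx.
apply: le_trans (ler_wpM2r (ler0n R x) cP) _; rewrite -natrM ler_nat.
rewrite -sum1_card big_distrl /= [leqRHS](bigID (fun v => (k <= d v)%N)) /=.
apply: leq_trans (leq_addr _ _).
rewrite (eq_bigl (fun v => (k <= d v)%N)); last by move=> v; rewrite !inE.
by apply: leq_sum => v kv; rewrite mul1n gx.
Qed.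

(** For [k >= 2], [(j * (j - 1)) ^ 2 <= j ^ 4 <= j ^ (2 * k)]; for [k = 1] the
    left-hand side is zero. *)
Lemma twins_square_moment (R : realFieldType) (V : finType) (d : V -> nat) (k : nat) :
  (0 < #|V|)%N ->
  (k * k.-1 * twins_square d)%:R <= k%:R ^+ 2 * (#|V|%:R * moment R d (2 * k)).
Proof.
move=> V0; rewrite momentE // -natrX -natrM ler_nat.
case: k => [//|[|k]]; first by rewrite muln0 mul0n.
rewrite leq_mul //; first by rewrite leq_mul2l leqnSn orbT.
apply: leq_sum => v _; case: (d v) => [//|x].
apply: (@leq_trans (x.+1 ^ 4)%N).
  by rewrite (expnM _ 2 2) leq_exp2r // -mulnn leq_mul2l leqnSn orbT.
by rewrite leq_pexp2l //; lia.
Qed.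

Section Error.
Variables (R : realFieldType) (V : finType) (d : V -> nat) (k : nat) (c h K : R).
Hypotheses (V0 : (0 < #|V|)%N) (k0 : (0 < k)%N) (kK : k%:R <= K) (c0 : 0 < c) (h0 : 0 < h).
Hypothesis large : c <= prob R [set: V]%SET (fun v => (2 * k <= d v)%N).
Hypothesis n_large : 4 * K ^+ 2 <= h * c * #|V|%:R.
Hypothesis mom_small : K ^+ 2 * moment R d (2 * k) <= h * c ^+ 2 * #|V|%:R.

Lemma stubs_large : c * #|V|%:R * (2 * k)%:R <= (stubs_total d)%:R.
Proof. exact: (many_large_degrees (g := id) V0 large). Qed.

Lemma relative_errors_small : relative_errors_leq d k h.
Proof.
have n0 : 0 < #|V|%:R :> R by rewrite ltr0n.
have cn0 : 0 < c * #|V|%:R by rewrite mulr_gt0.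
have twins_large : c * #|V|%:R <= (twins_total d)%:R.
  rewrite -[leLHS]mulr1.
  apply: (many_large_degrees (g := fun j => (j * j.-1)%N) (x := 1%N) V0 large).
  by move=> [|[|j]]; lia.
have stubs_large1 : c * #|V|%:R <= (stubs_total d)%:R.
  apply: le_trans stubs_large; rewrite ler_pMr // ler1n; lia.
have t0 := lt_le_trans cn0 twins_large; have s0 := lt_le_trans cn0 stubs_large1.
split; [by rewrite -(ltr0n R)|by rewrite -(ltr0n R)| |].
  rewrite ler_pdivrMr ?exprn_gt0 //.
  apply: le_trans (twins_square_moment _ _ _ V0) _.
  have M0 : 0 <= moment R d (2 * k).
    by rewrite /moment /expect divr_ge0 // sumr_ge0 // => v _; rewrite exprn_ge0.
  apply: (@le_trans _ _ (h * (c * #|V|%:R) ^+ 2)); last first.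
    by rewrite ler_pM2l // ler_pXn2r ?nnegrE // ltW.
  have -> : h * (c * #|V|%:R) ^+ 2 = #|V|%:R * (h * c ^+ 2 * #|V|%:R) by ring.
  rewrite mulrCA ler_pM2l //; apply: le_trans mom_small.
  by rewrite ler_wpM2r // ler_pXn2r ?nnegrE // (le_trans _ kK).
rewrite ler_pdivrMr //.
apply: (@le_trans _ _ (h * (c * #|V|%:R))); last by rewrite ler_pM2l.
rewrite mulrA; apply: le_trans n_large.
rewrite natrM exprMn -natrX ler_pM2l ?ltr0n //.
by rewrite ler_pXn2r ?nnegrE // (le_trans _ kK).
Qed.

End Error.

(** The number of hyperedges is the number of stubs divided by [k]. *)
Lemma many_edges (R : realFieldType) (V E : finType) (d : V -> nat) (delta : E -> nat)
    (k : nat) (c h K : R) :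
  (0 < #|V|)%N -> (0 < k)%N -> k%:R <= K -> 0 < c -> 0 < h ->
  c <= prob R [set: V]%SET (fun v => (2 * k <= d v)%N) ->
  4 * K ^+ 2 <= h * c * #|V|%:R ->
  (\sum_v d v = \sum_e delta e)%N -> (forall e, delta e = k) ->
  (0 < #|E|)%N /\ #|E|%:R^-1 <= h.
Proof.
move=> V0 k0 kK c0 h0 large n_large eq_sum delta_k.
have cn0 : 0 < c * #|V|%:R by rewrite mulr_gt0 // ltr0n.
have k1 : 1 <= k%:R :> R by rewrite ler1n.
have mle : c * #|V|%:R <= #|E|%:R.
  have := stubs_large V0 large; rewrite /stubs_total eq_sum.
  rewrite (eq_bigr (fun=> k)) ?sum_nat_const // !natrM mulrA ler_pM2r ?ltr0n //.
  by apply: le_trans; rewrite ler_pMr // ler1n.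
have m0 := lt_le_trans cn0 mle.
split; first by rewrite -(ltr0n R).
rewrite -[X in X <= _]mul1r ler_pdivrMr //.
apply: (@le_trans _ _ (h * (c * #|V|%:R))); last by rewrite ler_pM2l.
rewrite mulrA; apply: le_trans n_large; nra.
Qed.

(** * Asymptotics *)

From mathcomp Require Import all_classical all_reals all_analysis.
Import Order.TTheory GRing.Theory Num.Theory numFieldNormedType.Exports.
Local Open Scope ring_scope.
Local Open Scope classical_set_scope.

Lemma bigO1_nat_bounded (R : realType) (u : nat -> nat) :
  (fun i => (u i)%:R : R) =O_\oo (fun=> 1 : R) ->
  exists2 K : R, 0 < K & \forall i \near \oo, (u i)%:R <= K.
Proof.
move=> /eqOP [K [_ HK]]; exists (Num.max 1 (K + 1)).
  by rewrite lt_max ltr01.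
have /HK : K < Num.max 1 (K + 1) by rewrite lt_max ltrDl ltr01 orbT.
apply: filterS => i; by rewrite normr1 mulr1 ger0_norm.
Qed.

Lemma near_nat_large (R : realType) (u : nat -> nat) (x y : R) :
  u i @[i --> \oo] --> \oo -> 0 < y ->
  \forall i \near \oo, x <= y * (u i)%:R.
Proof.
move=> uoo y0; have [N Nx] : exists N : nat, x / y <= N%:R.
  exists (Num.Def.archi_bound `|x / y|).
  by apply: le_trans (ler_norm _) (ltW (archi_boundP _)).
have uN : \forall i \near \oo, (N <= u i)%N := uoo _ (nbhs_infty_ge N).
near=> i; have Ni : (N <= u i)%N by near: i.
by rewrite mulrC -ler_pdivrMr //; apply: le_trans Nx _; rewrite ler_nat.
Unshelve. all: by end_near. Qed.

Theorem lemma4p1 (R : realType) (V E : nat -> finType)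
    (D : forall i : nat, degree_sequence (V i) (E i))
    (n : nat -> nat) (deltat deltah : nat -> nat)
    (hn : forall i : nat, n i = #|V i|)
    (hoo : n i @[i --> \oo] --> \oo)
    (ht : forall (i : nat) (e : E i), dtail (D i) e = deltat i)
    (hh : forall (i : nat) (e : E i), dhead (D i) e = deltah i)
    (ht_gt0 : forall i : nat, (0 < deltat i)%N)
    (hh_gt0 : forall i : nat, (0 < deltah i)%N)
    (htO : (fun i : nat => (deltat i)%:R : R) =O_\oo (fun _ : nat => 1 : R))
    (hhO : (fun i : nat => (deltah i)%:R : R) =O_\oo (fun _ : nat => 1 : R))
    (hmom_out : (fun i : nat => moment R (dout (D i)) (2 * deltat i))
                  =o_\oo (fun i : nat => (n i)%:R : R))
    (hmom_in : (fun i : nat => moment R (din (D i)) (2 * deltah i))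
                  =o_\oo (fun i : nat => (n i)%:R : R))
    (hlow : exists2 c : R, 0 < c & \forall i \near \oo,
       c <= prob R [set: V i]%SET (fun v => (2 * deltat i <= dout (D i) v)%N) /\
       c <= prob R [set: V i]%SET (fun v => (2 * deltah i <= din (D i) v)%N)) :
  exists2 eps : nat -> R, eps i @[i --> \oo] --> (0 : R) &
  \forall i \near \oo,
    expected_multi_pairs R (D i) =
      ((deltat i).-1)`!%:R * ((deltah i).-1)`!%:R / 2 * (n i)%:R ^+ 2
      * moment R (dout (D i)) 1%N * moment R (din (D i)) 1%N
      * ((moment R (dout (D i)) 2%N - moment R (dout (D i)) 1%N) / ((n i)%:R * moment R (dout (D i)) 1%N ^+ 2)) ^+ deltat i
      * ((moment R (din (D i)) 2%N - moment R (din (D i)) 1%N) / ((n i)%:R * moment R (din (D i)) 1%N ^+ 2)) ^+ deltah i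
      * (1 + eps i).
Proof.
have [c c0 large] := hlow.
have [Kt Kt0 ltKt] := bigO1_nat_bounded htO.
have [Kh Kh0 ltKh] := bigO1_nat_bounded hhO.
pose K := Num.max Kt Kh.
have K0 : 0 < K by rewrite lt_max Kt0.
pose main i : R := #|E i|%:R ^+ 2 / 2
  * coincidence_estimate R (dout (D i)) (deltat i) * coincidence_estimate R (din (D i)) (deltah i).
have errors (h : R) : 0 < h -> \forall i \near \oo,
    [/\ (0 < #|V i|)%N, relative_errors_leq (dout (D i)) (deltat i) h,
      relative_errors_leq (din (D i)) (deltah i) h, (0 < #|E i|)%N & #|E i|%:R^-1 <= h].
  move=> h0; have hc0 : 0 < h * c by rewrite mulr_gt0.
  have e0 : 0 < h * c ^+ 2 / K ^+ 2 by rewrite divr_gt0 ?mulr_gt0 ?exprn_gt0.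
  have n1 := near_nat_large 1 hoo ltr01.
  have nl := near_nat_large (4 * K ^+ 2) hoo hc0.
  have small_mom (u : nat -> R) (N : nat) : u N <= h * c ^+ 2 / K ^+ 2 * (n N)%:R ->
      K ^+ 2 * u N <= h * c ^+ 2 * (n N)%:R.
    move=> uN; rewrite -(ler_pM2l (exprn_gt0 2 K0)) in uN; apply: le_trans uN _.
    by rewrite mulrA mulrCA mulfV ?mulr1 // gt_eqF ?exprn_gt0.
  have mt : \forall i \near \oo, K ^+ 2 * moment R (dout (D i)) (2 * deltat i)
                              <= h * c ^+ 2 * (n i)%:R.
    have /eqoP/(_ _ e0) := hmom_out; apply: filterS => i le_i.
    apply: (small_mom (fun i => moment R (dout (D i)) (2 * deltat i))).
    by apply: le_trans (ler_norm _) _; apply: le_trans le_i _; rewrite (ger0_norm (ler0n _ _)).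
  have mh : \forall i \near \oo, K ^+ 2 * moment R (din (D i)) (2 * deltah i)
                              <= h * c ^+ 2 * (n i)%:R.
    have /eqoP/(_ _ e0) := hmom_in; apply: filterS => i le_i.
    apply: (small_mom (fun i => moment R (din (D i)) (2 * deltah i))).
    by apply: le_trans (ler_norm _) _; apply: le_trans le_i _; rewrite (ger0_norm (ler0n _ _)).
  near=> i.
  have V0 : (0 < #|V i|)%N.
    have : 1 <= 1 * (n i)%:R :> R by near: i.
    by rewrite mul1r ler1n hn.
  have [ct ch] : c <= prob R [set: V i]%SET (fun v => (2 * deltat i <= dout (D i) v)%N) /\
       c <= prob R [set: V i]%SET (fun v => (2 * deltah i <= din (D i) v)%N) by near: i.
  have Kti : (deltat i)%:R <= K by rewrite le_max; apply/orP; left; near: i.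
  have Khi : (deltah i)%:R <= K by rewrite le_max; apply/orP; right; near: i.
  have nli : 4 * K ^+ 2 <= h * c * #|V i|%:R by rewrite -hn; near: i.
  have [E0 Eh] := many_edges V0 (ht_gt0 i) Kti c0 h0 ct nli (sum_dout (D i)) (@ht i).
  have mti : K ^+ 2 * moment R (dout (D i)) (2 * deltat i) <= h * c ^+ 2 * #|V i|%:R.
    by rewrite -hn; near: i.
  have mhi : K ^+ 2 * moment R (din (D i)) (2 * deltah i) <= h * c ^+ 2 * #|V i|%:R.
    by rewrite -hn; near: i.
  split=> //; first exact: relative_errors_small Kti c0 h0 ct nli mti.
  exact: relative_errors_small Khi c0 h0 ch nli mhi.
exists (fun i => expected_multi_pairs R (D i) / main i - 1).
  apply/cvgr0Pnorm_le => e e0.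
  have h0 : 0 < Num.min (4^-1) (e / 8) :> R by rewrite lt_min invr_gt0 divr_gt0 ?ltr0n.
  have := errors _ h0; apply: filterS => i [V0 errt errh E0 Eh].
  have := expected_multi_pairs_bounds (@ht i) (@hh i) (ht_gt0 i) (hh_gt0 i) _ errt errh E0 Eh.
  rewrite ge_min lexx => /(_ isT) bound; apply: le_trans bound _.
  have : Num.min (4^-1) (e / 8) <= e / 8 by rewrite ge_min lexx orbT.
  by move: (Num.min _ _) => h; lra.
have := errors _ ltr01; apply: filterS => i [V0 [st0 tt0 _ _] [sh0 th0 _ _] E0 _].
rewrite hn -main_term // -/(main i) subrKC mulrC divfK // gt_eqF // /main.
apply: mulr_gt0 (coincidence_gt0 _ _ sh0 th0).
apply: mulr_gt0 (coincidence_gt0 _ _ st0 tt0).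
by rewrite divr_gt0 ?exprn_gt0 ?ltr0n.
Unshelve. all: by end_near. Qed.
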